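(* For $n\ge 1$ let $\tau_n$ denote the kissing number in $\mathbb{R}^n$, i.e. the maximal number $N$ of points $x_1,\dots,x_N$ on the unit sphere $S^{n-1}\subset\mathbb{R}^n$ with $\langle x_i,x_j\rangle\le 1/2$ for all $i\neq j$. Then $\tau_{25}\ge 197048$, $\tau_{26}\ge 198512$, $\tau_{27}\ge 199976$, $\tau_{28}\ge 204368$, $\tau_{29}\ge 208272$, $\tau_{30}\ge 219984$, and $\tau_{31}\ge 232874$.
   Context: The kissing number in $\mathbb{R}^n$ is equivalently the maximal number of non-overlapping unit balls that are externally tangent to a fixed unit ball. *)

(* Defs.v *)
From HB Require Import structures.
From mathcomp Require Import all_boot all_order all_algebra.
From mathcomp Require Import reals.
From Stdlib Require Export BinNums PosDef NArith.BinNatDef.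
Set Implicit Arguments. Unset Strict Implicit. Unset Printing Implicit Defensive.
Import Order.TTheory GRing.Theory Num.Theory.
Local Open Scope ring_scope.

Definition dotp (R : realType) (n : nat) (u v : 'rV[R]_n) : R :=
  \sum_(k < n) u 0 k * v 0 k.

Definition kissing_config (R : realType) (n N : nat) (x : 'I_N -> 'rV[R]_n) : Prop :=
  (forall i, dotp (x i) (x i) = 1) /\
  (forall i j, i != j -> dotp (x i) (x j) <= 1 / 2).

(* N is given in binary (BinNat.N, scope %num) to avoid building huge unary
   nat literals; it is coerced to nat via nat_of_bin. *)
Definition kissing_number_ge (R : realType) (n : nat) (N : BinNums.N) : Prop :=
  exists x : 'I_(nat_of_bin N) -> 'rV[R]_n, kissing_config x.

(* Main.v *)
(** Normalize the 196560 minimal vectors of the Leech lattice to length 1; their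
    pairwise inner products are then at most 1/2. Let S_1, ..., S_m be disjoint
    sets of minimal vectors such that the inner products within each S_i are at
    most 1/4, and let T_1, ..., T_m be disjoint equilateral triangles inscribed
    in great circles, whose vertices together form a kissing configuration in
    R^k. Replace each x in S_i by the three vectors (sqrt(2/3) x, sqrt(1/3) y)
    with y in T_i. The inner product of two new vectors is at most
    2/3 - 1/3 * 1/2 if x = x', at most 2/3 * 1/4 + 1/3 if x and x' are distinct
    elements of the same S_i, and at most 2/3 * 1/2 + 1/3 * 1/2 otherwise, that
    is, always at most 1/2. So 2 (|S_1| + ... + |S_m|) points are gained in
    R^(24+k). The triangles come from the root systems A2, D3, D4, D5, E6 and
    E7; for k = 1 an antipodal pair takes the role of the triangle. The S_i are
    images under automorphisms of a single set of 498 vectors, with overlaps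
    removed. *)
From HB Require Import structures.
Require Import Defs.
From mathcomp Require Import all_boot all_order all_algebra reals.
From mathcomp Require Import zify ring lra.
Set Implicit Arguments.
Unset Strict Implicit.
Unset Printing Implicit Defensive.
Import Order.TTheory GRing.Theory Num.Theory.

Local Open Scope ring_scope.

(** * Kissing families *)

Section KissingFamily.
Variable R : realType.

Lemma dotpC n (u v : 'rV[R]_n) : dotp u v = dotp v u.
Proof. by apply: eq_bigr => k _; rewrite mulrC. Qed.

Lemma dotp0l n (v : 'rV[R]_n) : dotp 0 v = 0.
Proof. by apply: big1 => k _; rewrite mxE mul0r. Qed.

Lemma dotpZ n (a b : R) (u v : 'rV[R]_n) :
  dotp (a *: u) (b *: v) = a * b * dotp u v.
Proof.
by rewrite /dotp mulr_sumr; apply: eq_bigr => k _; rewrite !mxE mulrACA.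
Qed.

Lemma dotp_row_mx m n (u v : 'rV[R]_m) (u' v' : 'rV[R]_n) :
  dotp (row_mx u u') (row_mx v v') = dotp u v + dotp u' v'.
Proof.
rewrite /dotp big_split_ord /=.
by congr (_ + _); apply: eq_bigr => k _; rewrite ?row_mxEl ?row_mxEr.
Qed.

Definition kissing_family n (I : eqType) (x : I -> 'rV[R]_n) : Prop :=
  (forall i, dotp (x i) (x i) = 1) /\
  (forall i j, i != j -> dotp (x i) (x j) <= 1 / 2).

Lemma kissing_number_ge_family n (I : finType) (x : I -> 'rV[R]_n) N :
  kissing_family x -> (nat_of_bin N <= #|I|)%N -> kissing_number_ge R n N.
Proof.
move=> [x_unit x_dotp] leNI.
exists (fun k => x (enum_val (widen_ord leNI k))).
split=> [k|k l neq_kl]; first exact: x_unit.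
apply: x_dotp; apply: contraNneq neq_kl => /enum_val_inj/(congr1 val) eq_kl.
exact/eqP/val_inj.
Qed.

Section Lift.
Variables (m k : nat) (I K J C : eqType).
Variables (x : I + K -> 'rV[R]_m) (y : J * C -> 'rV[R]_k) (label : K -> J).
Hypothesis x_kissing : kissing_family x.
Hypothesis x_dotp_label : forall s t, s != t -> label s = label t ->
  dotp (x (inr s)) (x (inr t)) <= 1 / 4.
Hypothesis y_kissing : kissing_family y.
Hypothesis y_dotp_fiber : forall j c d, c != d ->
  dotp (y (j, c)) (y (j, d)) <= - (1 / 2).

Definition lift_family (p : I + K * C) : 'rV[R]_(m + k) :=
  match p with
  | inl i => row_mx (x (inl i)) 0
  | inr (s, c) =>
      row_mx (Num.sqrt (2 / 3) *: x (inr s))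
             (Num.sqrt (1 / 3) *: y (label s, c))
  end.

Lemma dotp_lift_inll i j :
  dotp (lift_family (inl i)) (lift_family (inl j)) =
  dotp (x (inl i)) (x (inl j)).
Proof. by rewrite dotp_row_mx dotp0l addr0. Qed.

Lemma dotp_lift_inlr i s c :
  dotp (lift_family (inl i)) (lift_family (inr (s, c))) =
  Num.sqrt (2 / 3) * dotp (x (inl i)) (x (inr s)).
Proof.
by rewrite dotp_row_mx dotp0l addr0 -[x (inl i)]scale1r dotpZ mul1r scale1r.
Qed.

Lemma dotp_lift_inrr s c t d :
  dotp (lift_family (inr (s, c))) (lift_family (inr (t, d))) =
  2 / 3 * dotp (x (inr s)) (x (inr t)) +
  1 / 3 * dotp (y (label s, c)) (y (label t, d)).
Proof. by rewrite dotp_row_mx !dotpZ -!expr2 !sqr_sqrtr; lra. Qed.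

Lemma dotp_lift_inlr_le i s c :
  dotp (lift_family (inl i)) (lift_family (inr (s, c))) <= 1 / 2.
Proof.
have [_ /(_ (inl i) (inr s) isT) x_le] := x_kissing.
rewrite dotp_lift_inlr; set r := Num.sqrt _.
have r_ge0 : 0 <= r by exact: sqrtr_ge0.
have r_le1 : r <= 1 by rewrite -[leRHS]sqrtr1; apply: ler_wsqrtr; lra.
have : r * dotp (x (inl i)) (x (inr s)) <= r * (1 / 2) by exact: ler_wpM2l.
lra.
Qed.

Lemma dotp_lift_inrr_le s c t d : (s, c) != (t, d) ->
  dotp (lift_family (inr (s, c))) (lift_family (inr (t, d))) <= 1 / 2.
Proof.
have [[x_unit x_le] [y_unit y_le]] := (x_kissing, y_kissing).
rewrite dotp_lift_inrr; have [<-|neq_st _] := eqVneq s t.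
  rewrite xpair_eqE eqxx /= => /(y_dotp_fiber (label s)).
  by rewrite x_unit; lra.
have [eq_st|neq_label] := eqVneq (label s) (label t).
  have y_le1 : dotp (y (label s, c)) (y (label t, d)) <= 1.
    rewrite eq_st; have [<-|neq_cd] := eqVneq c d; first by rewrite y_unit.
    have := y_dotp_fiber (label t) neq_cd; lra.
  have := x_dotp_label neq_st eq_st; lra.
have /x_le x_le2 : inr s != inr t :> I + K by [].
have : (label s, c) != (label t, d) by rewrite xpair_eqE negb_and neq_label.
by move=> /y_le; lra.
Qed.

Lemma kissing_lift : kissing_family lift_family.
Proof.
have [[x_unit x_le] [y_unit _]] := (x_kissing, y_kissing).
split=> [[i|[s c]]|[i|[s c]] [j|[t d]] neq_pq].
- by rewrite dotp_lift_inll x_unit.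
- by rewrite dotp_lift_inrr x_unit y_unit; lra.
- by rewrite dotp_lift_inll x_le.
- exact: dotp_lift_inlr_le.
- by rewrite dotpC dotp_lift_inlr_le.
- exact: dotp_lift_inrr_le.
Qed.

End Lift.
End KissingFamily.

(** * Sequences *)

Definition zipwith (A B C : Type) (f : A -> B -> C) (s : seq A) (t : seq B) :
    seq C := [seq f p.1 p.2 | p <- zip s t].

Lemma size_zipwith (A B C : Type) (f : A -> B -> C) s t :
  size (zipwith f s t) = minn (size s) (size t).
Proof. by rewrite size_map size_zip. Qed.

Lemma nth_zipwith (A B C : Type) (f : A -> B -> C) a b c s t i :
  (i < size s)%N -> (i < size t)%N ->
  nth c (zipwith f s t) i = f (nth a s i) (nth b t i).
Proof.
move=> si ti; have sti : (i < size (zip s t))%N by rewrite size_zip leq_min si.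
by rewrite (nth_map (a, b)) // nth_zip_cond sti.
Qed.

Lemma zipwith_map (I A B C : Type) (f : A -> B -> C) (g : I -> A) (h : I -> B)
    p :
  zipwith f (map g p) (map h p) = [seq f (g i) (h i) | i <- p].
Proof. by rewrite /zipwith zip_map -map_comp. Qed.

Definition permute (T : Type) (x0 : T) (p : seq nat) (x : seq T) : seq T :=
  [seq nth x0 x i | i <- p].

Lemma pairwise_nth (T : Type) (r : rel T) (x0 : T) s i j :
  symmetric r -> pairwise r s -> (i < size s)%N -> (j < size s)%N -> i != j ->
  r (nth x0 s i) (nth x0 s j).
Proof.
move=> r_sym /(pairwiseP x0) r_s si sj; rewrite neq_ltn => /orP[ij|ji].
  exact: r_s.
by rewrite r_sym; apply: r_s.
Qed.

Definition set_index (T : eqType) (Ss : seq (seq T)) (x : T) : nat :=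
  find (fun S : seq T => x \in S) Ss.

Lemma set_indexP (T : eqType) (Ss : seq (seq T)) x : x \in flatten Ss ->
  (set_index Ss x < size Ss)%N /\ x \in nth [::] Ss (set_index Ss x).
Proof.
move=> /flattenP/hasP Ss_has.
by split; [rewrite -has_find | apply: (nth_find [::] Ss_has)].
Qed.

Definition union_size (T : eqType) (Ss : seq (seq T)) : nat :=
  size (undup (flatten Ss)).

Section Dedup.
Variables (disp : Order.disp_t) (T : orderType disp).
Implicit Types s : seq T.

Definition dedup s : seq T :=
  foldr (fun x t => if ohead t == Some x then t else x :: t) [::] s.

Lemma mem_dedup s : dedup s =i s.
Proof.
elim: s => //= x s IH y; rewrite inE -IH.
case: eqP => [|_]; last by rewrite inE.
by case: (dedup s) => // z t [->]; rewrite inE orbA orbb.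
Qed.

Lemma dedup_sorted s : sorted <=%O s -> sorted <%O (dedup s).
Proof.
elim: s => //= x s IH le_xs; have := IH (path_sorted le_xs).
case def_t: (dedup s) => [|y t] //= sorted_yt; case: eqP => //= neq_yx.
have ys : y \in s by rewrite -mem_dedup def_t mem_head.
have le_xy := allP (order_path_min le_trans le_xs) y ys.
rewrite sorted_yt lt_neqAle le_xy !andbT.
by apply/eqP => eq_xy; apply: neq_yx; rewrite eq_xy.
Qed.

(* [undup] takes quadratic time, which is too slow for the union of the sets
   [S_i]. *)
Lemma size_undup_sort s : size (undup s) = size (dedup (sort <=%O s)).
Proof.
apply/perm_size/uniq_perm; first exact: undup_uniq.
  exact/lt_sorted_uniq/dedup_sorted/sort_le_sorted.
by move=> x; rewrite mem_undup mem_dedup mem_sort.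
Qed.

End Dedup.

Lemma map_const (S T : Type) (a : T) (s : seq S) :
  map (fun=> a) s = nseq (size s) a.
Proof. by elim: s => //= b s ->. Qed.

Lemma allpairs_fibers_uniq (S T : eqType) (f : S -> seq T) (g : T -> S) ss :
  {in ss, forall s, uniq (f s)} ->
  {in ss, forall s, {in f s, forall x, g x = s}} ->
  uniq ss -> uniq [seq x | s <- ss, x <- f s].
Proof.
move=> f_uniq fK ss_uniq; apply: allpairs_uniq_dep => // p q.
move=> /allpairsPdep[s [x [ss_s fs_x ->]]].
move=> /allpairsPdep[t [y [ss_t ft_y ->]]] /= eq_xy.
by move: ft_y; rewrite -eq_xy => /(fK _ ss_t) <-; rewrite (fK _ ss_s).
Qed.

Lemma size_allpairs_fibers (S : eqType) (T : Type) (f : S -> seq T) n ss :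
  {in ss, forall s, size (f s) = n} ->
  size [seq x | s <- ss, x <- f s] = (size ss * n)%N.
Proof.
move=> f_size; rewrite size_allpairs_dep.
have /eq_in_map -> : {in ss, forall s, size (f s) = n} by [].
by rewrite map_const sumn_nseq mulnC.
Qed.

Definition cartesian (T : Type) (ss : seq (seq T)) : seq (seq T) :=
  foldr (fun s xs => [seq a :: x | a <- s, x <- xs]) [:: [::]] ss.

Lemma mem_cartesian (T : eqType) (ss : seq (seq T)) x :
  (x \in cartesian ss) = all2 (fun a s => a \in s) x ss.
Proof.
elim: ss x => [|s ss IH] [|a x] //=.
  by apply/negP => /allpairsP[[b y] []].
rewrite -IH; apply/allpairsP/andP => [[[b y] /= [sb ssy [-> ->]]] //|[sa ssx]].
by exists (a, x).
Qed.

Lemma cartesian_uniq (T : eqType) (ss : seq (seq T)) :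
  all uniq ss -> uniq (cartesian ss).
Proof.
elim: ss => //= s ss IH /andP[s_uniq /IH ss_uniq].
by apply: allpairs_uniq => // -[a x] [b y] _ _ [-> ->].
Qed.

Lemma size_cartesian (T : Type) (ss : seq (seq T)) :
  size (cartesian ss) = (\prod_(s <- ss) size s)%N.
Proof.
by elim: ss => [|s ss IH]; rewrite ?big_nil ?big_cons //= size_allpairs IH.
Qed.

Definition wt (c : seq bool) : nat := count id c.

Definition words n : seq (seq bool) := cartesian (nseq n [:: false; true]).

Lemma mem_words n c : (c \in words n) = (size c == n).
Proof.
rewrite mem_cartesian; elim: n c => [|n IH] [|b c] //=.
by rewrite IH !inE; case: b.
Qed.

Lemma words_uniq n : uniq (words n).
Proof. by apply: cartesian_uniq; rewrite all_nseq orbT. Qed.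

Lemma size_words n : size (words n) = (2 ^ n)%N.
Proof. by rewrite size_cartesian big_nseq iter_muln_1. Qed.

Fixpoint words_of_weight n k : seq (seq bool) :=
  match n, k with
  | 0, 0 => [:: [::]]
  | 0, _.+1 => [::]
  | n'.+1, 0 => map (cons false) (words_of_weight n' 0)
  | n'.+1, k'.+1 => map (cons false) (words_of_weight n' k) ++
                    map (cons true) (words_of_weight n' k')
  end%N.

Lemma cons_inj (T : Type) (a : T) : injective (cons a).
Proof. by move=> x y []. Qed.

Lemma mem_words_of_weight n k c :
  (c \in words_of_weight n k) = (size c == n) && (wt c == k).
Proof.
have mem_cons (a b : bool) c' (s : seq (seq bool)) :
    (a :: c' \in map (cons b) s) = (a == b) && (c' \in s).
  have [->|neq_ab] := eqVneq a b; first by rewrite mem_map //; apply: cons_inj.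
  by apply/mapP => -[d _ [eq_ab _]]; rewrite eq_ab eqxx in neq_ab.
rewrite /wt; elim: n k c => [|n IH] [|k] [|b c] //=.
- by apply/mapP => -[].
- by rewrite mem_cons IH; case: b; rewrite ?andbF.
- by rewrite mem_cat; apply/orP => -[] /mapP[].
- by rewrite mem_cat !mem_cons !IH; case: b; rewrite ?orbF.
Qed.

Lemma words_of_weight_uniq n k : uniq (words_of_weight n k).
Proof.
elim: n k => [|n IH] [|k] //=.
  by rewrite map_inj_uniq //; apply: cons_inj.
rewrite cat_uniq !map_inj_uniq ?IH /= ?andbT; try exact: cons_inj.
by apply/hasPn => c /mapP[d _ ->]; apply/mapP => -[].
Qed.

Lemma size_words_of_weight n k : size (words_of_weight n k) = 'C(n, k).
Proof.
by elim: n k => [|n IH] [|k] //=; rewrite ?size_cat !size_map !IH ?bin0.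
Qed.

(** * Integer vectors *)

Definition sumz (x : seq int) : int := foldr +%R 0 x.

Definition dot (x y : seq int) : int := sumz (zipwith *%R x y).

Definition vsub : seq int -> seq int -> seq int := zipwith (fun a b => a - b).

Definition wdot (w x y : seq int) : int := dot (zipwith *%R w x) y.

Lemma nth_zipwith_mul (x y : seq int) i : (zipwith *%R x y)`_i = x`_i * y`_i.
Proof.
have [xi|xi] := ltnP i (size x); last first.
  by rewrite (nth_default _ xi) nth_default ?mul0r ?size_zipwith ?geq_min ?xi.
have [yi|yi] := ltnP i (size y); first exact: nth_zipwith.
rewrite (nth_default _ yi) nth_default ?mulr0 //.
by rewrite size_zipwith geq_min yi orbT.
Qed.

Lemma sumz_nth n x : (size x <= n)%N -> sumz x = \sum_(0 <= i < n) x`_i.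
Proof.
move=> xn; rewrite /sumz foldrE (big_nth 0) [RHS](big_cat_nat (leq0n _) xn) /=.
rewrite [X in _ + X]big_nat_cond [X in _ + X]big1 ?addr0 // => i.
by rewrite andbT => /andP[/(nth_default _) ->].
Qed.

Lemma dot_nth n x y : (minn (size x) (size y) <= n)%N ->
  dot x y = \sum_(0 <= i < n) x`_i * y`_i.
Proof.
move=> xyn; rewrite /dot (sumz_nth (n := n)) ?size_zipwith //.
by apply: eq_bigr => i _; rewrite nth_zipwith_mul.
Qed.

Lemma wdot_nth w x y :
  wdot w x y = \sum_(0 <= i < size w) w`_i * x`_i * y`_i.
Proof.
rewrite /wdot (@dot_nth (size w)) ?size_zipwith -?minnA ?geq_minl //.
by apply: eq_bigr => i _; rewrite nth_zipwith_mul.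
Qed.

Lemma dot_cons a x b y : dot (a :: x) (b :: y) = a * b + dot x y.
Proof. by []. Qed.

Lemma dotC x y : dot x y = dot y x.
Proof.
rewrite !(@dot_nth (minn (size x) (size y))) //; last by rewrite minnC.
by apply: eq_bigr => i _; rewrite mulrC.
Qed.

Lemma dot_ge0 x : 0 <= dot x x.
Proof.
by rewrite (dot_nth (leqnn _)); apply: sumr_ge0 => i _; rewrite -expr2 sqr_ge0.
Qed.

Lemma dot_eq0 x : dot x x = 0 -> x = nseq (size x) 0.
Proof.
move=> /eqP; rewrite (@dot_nth (size x)) ?minnn // big_mkord.
rewrite psumr_eq0 => [/allP x0|i _]; last by rewrite -expr2 sqr_ge0.
apply: (@eq_from_nth _ 0) => [|i xi]; first by rewrite size_nseq.
rewrite nth_nseq xi; apply/eqP; rewrite -sqrf_eq0 expr2.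
exact: (x0 (Ordinal xi) (mem_index_enum _)).
Qed.

Lemma wdot_nseq1 n x y : size x = n -> wdot (nseq n 1) x y = dot x y.
Proof.
move=> xn; rewrite wdot_nth size_nseq (@dot_nth n) ?geq_min ?xn ?leqnn //.
by apply: eq_big_nat => i /= ni; rewrite nth_nseq ni mul1r.
Qed.

Lemma wdotC w x y : wdot w x y = wdot w y x.
Proof. by rewrite !wdot_nth; apply: eq_bigr => i _; rewrite mulrAC. Qed.

Lemma nth_vsub x y i : size x = size y -> (vsub x y)`_i = x`_i - y`_i.
Proof.
move=> sxy; have [xi|xi] := ltnP i (size x).
  by apply: nth_zipwith; rewrite -?sxy.
by rewrite !nth_default ?subr0 ?size_zipwith ?geq_min -?sxy ?xi.
Qed.

Lemma size_vsub x y : size x = size y -> size (vsub x y) = size y.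
Proof. by rewrite size_zipwith => ->; rewrite minnn. Qed.

Lemma sumz_vsub x y : size x = size y -> sumz (vsub x y) = sumz x - sumz y.
Proof.
move=> sxy; rewrite !(@sumz_nth (size y)) ?size_vsub ?sxy // -sumrB.
by apply: eq_bigr => i _; rewrite nth_vsub.
Qed.

Lemma dot_vsub x y : size x = size y ->
  dot (vsub x y) (vsub x y) = dot x x + dot y y - 2 * dot x y.
Proof.
move=> sxy; rewrite !(@dot_nth (size y)) ?size_vsub ?sxy ?minnn //.
rewrite mulr_sumr -sumrN -!big_split; apply: eq_bigr => i _ /=.
by rewrite nth_vsub //; ring.
Qed.

Lemma vsub_eq0 x y : size x = size y -> dot (vsub x y) (vsub x y) = 0 -> x = y.
Proof.
move=> sxy /dot_eq0 xy0; apply: (@eq_from_nth _ 0) => // i xi.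
by apply/eqP; rewrite -subr_eq0 -nth_vsub // xy0 nth_nseq if_same.
Qed.

Section Permute.
Variables (n : nat) (p : seq nat).
Hypothesis perm_p : perm_eq p (iota 0 n).

Let sum_permuted (f : nat -> int) : \sum_(i <- p) f i = \sum_(0 <= i < n) f i.
Proof. by rewrite /index_iota subn0; apply: perm_big. Qed.

Lemma sumz_permute x : size x = n -> sumz (permute 0 p x) = sumz x.
Proof.
by move=> xn; rewrite /sumz foldrE big_map sum_permuted -sumz_nth ?xn.
Qed.

Lemma dot_permute x y : size x = n -> size y = n ->
  dot (permute 0 p x) (permute 0 p y) = dot x y.
Proof.
move=> xn yn; rewrite /dot zipwith_map /sumz foldrE big_map sum_permuted.
by rewrite -dot_nth ?xn ?yn ?minnn.
Qed.

End Permute.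

Section Normalize.
Variable R : realType.

(* [w] lists the squared lengths of an orthogonal basis, and vectors of squared
   length [n] are scaled to length 1. *)
Definition normalize (w : seq int) (n : int) (x : seq int) : 'rV[R]_(size w) :=
  \row_i (Num.sqrt ((w`_i)%:~R / n%:~R) * (x`_i)%:~R).

Lemma dotp_normalize (w : seq int) (n : int) x y : all (>= 0) w -> 0 < n ->
  dotp (normalize w n x) (normalize w n y) = (wdot w x y)%:~R / n%:~R.
Proof.
move=> /allP w_ge0 n_gt0.
rewrite /dotp wdot_nth rmorph_sum mulr_suml /= big_mkord.
apply: eq_bigr => i _; rewrite !mxE mulrACA -expr2 sqr_sqrtr.
  by rewrite !intrM -!mulrA; congr (_ * _); rewrite mulrC mulrA.
by apply: divr_ge0; rewrite ler0z; [exact/w_ge0/mem_nth | exact: ltW].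
Qed.

Lemma dotp_normalize_le (w : seq int) (n : int) x y (p q : int) :
  all (>= 0) w -> 0 < n -> 0 < q ->
  (dotp (normalize w n x) (normalize w n y) <= p%:~R / q%:~R) =
  (q * wdot w x y <= p * n).
Proof.
move=> w_ge0 n_gt0 q_gt0; rewrite dotp_normalize //.
rewrite ler_pdivrMr ?ltr0z // mulrAC ler_pdivlMr ?ltr0z //.
by rewrite -!intrM ler_int mulrC.
Qed.

Lemma kissing_normalize (I : eqType) (w : seq int) (n : int)
    (v : I -> seq int) :
  all (>= 0) w -> 0 < n -> (forall i, wdot w (v i) (v i) = n) ->
  (forall i j, i != j -> 2 * wdot w (v i) (v j) <= n) ->
  kissing_family (fun i => normalize w n (v i)).
Proof.
move=> w_ge0 n_gt0 v_norm v_dot; split=> [i|i j neq_ij].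
  by rewrite dotp_normalize // v_norm divff // intr_eq0 gt_eqF.
by rewrite (@dotp_normalize_le _ _ _ _ 1 2) // mul1r; apply: v_dot.
Qed.

End Normalize.

(** * Vectors with prescribed support *)

Definition signings (v : int) (o : seq bool) : seq (seq int) :=
  cartesian [seq if b then [:: v; - v] else [:: 0] | b <- o].

Section Signings.
Variables (v : int) (o : seq bool).

Lemma signings_uniq : v != 0 -> uniq (signings v o).
Proof.
move=> v_neq0; apply/cartesian_uniq/allP => s /mapP[[] _ ->] //=.
by rewrite inE andbT; lia.
Qed.

Lemma size_signings : size (signings v o) = (2 ^ wt o)%N.
Proof.
rewrite size_cartesian big_map /wt.
by elim: o => [|[] o' IH]; rewrite ?big_nil ?big_cons ?IH ?mul1n ?expnS.
Qed.

Lemma signings_map (T : Type) (f : int -> T) (g : bool -> T) x :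
  f v = g true -> f (- v) = g true -> f 0 = g false ->
  x \in signings v o -> map f x = map g o.
Proof.
move=> fv fNv f0; rewrite mem_cartesian.
elim: o x => [|b o' IH] [|a x] //= /andP[av /IH ->]; congr cons.
by case: b av; rewrite !inE; [case/orP|]; move=> /eqP ->.
Qed.

Lemma dot_signing x : x \in signings v o -> dot x x = v * v *+ wt o.
Proof.
rewrite mem_cartesian /wt /dot.
elim: o x => [|b o' IH] [|a x] //= /andP[av /IH ->].
by case: b av; rewrite !inE; [case/orP|]; move=> /eqP ->;
  rewrite /= ?mulrNN ?mul0r ?add0r ?mulrS.
Qed.

Lemma sumz_signing x :
  x \in signings v o -> (2 * v %| sumz x - v *+ wt o)%Z.
Proof.
rewrite mem_cartesian /wt.
elim: o x => [|b o' IH] [|a x] //= /andP[av /IH dvd_x].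
rewrite mulrnDr opprD addrACA rpredD //.
case: b av; rewrite !inE; [case/orP|]; move=> /eqP ->.
- by rewrite subrr dvdz0.
- by apply/dvdzP; exists (-1); rewrite mulr1n; ring.
- by rewrite mulr0n subrr dvdz0.
Qed.

End Signings.

Lemma count_signings (o : seq bool) (r : int) :
  (0 < wt o)%N -> (r == 2 *+ wt o %[mod 4])%Z ->
  count (fun x => (sumz x == r %[mod 8])%Z) (signings 2 o) = (2 ^ (wt o).-1)%N.
Proof.
rewrite /wt /signings.
elim: o => [|[] o IH] //= wt_o r_mod; rewrite -/(signings 2 o) cats0;
    last first.
  by rewrite count_map -IH //; apply: eq_count => x /=; rewrite add0r.
rewrite count_cat !count_map -(size_signings 2).
rewrite -(count_predC (fun x => (sumz x == r - 2 %[mod 8])%Z)).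
congr addn; first by apply: eq_count => x /=; lia.
by apply: eq_in_count => x /sumz_signing/=; move: r_mod; rewrite /wt; lia.
Qed.

(** * The extended binary Golay code *)

Definition xorw : seq bool -> seq bool -> seq bool := zipwith addb.

Definition dotb (u v : seq bool) : bool := foldr addb false (zipwith andb u v).

Lemma dotb_xorw u c d :
  size c = size d -> dotb u (xorw c d) = dotb u c (+) dotb u d.
Proof.
rewrite /dotb; elim: u c d => [|a u IH] [|b c] [|e d] //= [/IH ->].
by rewrite andb_addr addbACA.
Qed.

(* Coordinates 0, ..., 22 are the residues mod 23 and coordinate 23 is the
   point at infinity of the extended quadratic residue code; the matrix gives
   its last twelve coordinates as linear functions of the first twelve. *)
Definition golay_matrix : seq (seq bool) := map (map odd)
  [:: [:: 1; 0; 1; 0; 0; 1; 0; 0; 1; 1; 1; 1];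
      [:: 1; 1; 1; 1; 0; 1; 1; 0; 1; 0; 0; 0];
      [:: 0; 1; 1; 1; 1; 0; 1; 1; 0; 1; 0; 0];
      [:: 0; 0; 1; 1; 1; 1; 0; 1; 1; 0; 1; 0];
      [:: 0; 0; 0; 1; 1; 1; 1; 0; 1; 1; 0; 1];
      [:: 1; 0; 1; 0; 1; 0; 1; 1; 1; 0; 0; 1];
      [:: 1; 1; 1; 1; 0; 0; 0; 1; 0; 0; 1; 1];
      [:: 1; 1; 0; 1; 1; 1; 0; 0; 0; 1; 1; 0];
      [:: 0; 1; 1; 0; 1; 1; 1; 0; 0; 0; 1; 1];
      [:: 1; 0; 0; 1; 0; 0; 1; 1; 1; 1; 1; 0];
      [:: 0; 1; 0; 0; 1; 0; 0; 1; 1; 1; 1; 1];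
      [:: 1; 1; 0; 0; 0; 1; 1; 1; 0; 1; 0; 1]]%N.

Definition encode (m : seq bool) : seq bool :=
  [seq dotb row m | row <- golay_matrix].

Definition golay (c : seq bool) : bool :=
  (size c == 24%N) && (drop 12 c == encode (take 12 c)).

Definition golay_words : seq (seq bool) := [seq m ++ encode m | m <- words 12].

Definition octads : seq (seq bool) := [seq c <- golay_words | wt c == 8%N].

Lemma size_golay c : golay c -> size c = 24%N.
Proof. by case/andP => /eqP. Qed.

Lemma encode_xorw m n :
  size m = size n -> encode (xorw m n) = xorw (encode m) (encode n).
Proof.
move=> smn; rewrite /xorw zipwith_map.
by apply: eq_map => row; apply: dotb_xorw.
Qed.

Lemma mem_golay_words c : (c \in golay_words) = golay c.
Proof.
apply/mapP/andP => [[m + ->]|[/eqP sc /eqP dc]].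
  rewrite mem_words => /eqP sm.
  by rewrite size_cat size_map sm take_size_cat // drop_size_cat.
exists (take 12 c); first by rewrite mem_words size_take sc.
by rewrite -dc cat_take_drop.
Qed.

Lemma golay_xorw c d : golay c -> golay d -> golay (xorw c d).
Proof.
rewrite -!mem_golay_words => /mapP[m + ->] /mapP[n + ->].
rewrite !mem_words => /eqP sm /eqP sn; apply/mapP; exists (xorw m n).
  by rewrite mem_words size_zipwith sm sn.
by rewrite encode_xorw ?sm ?sn // /xorw /zipwith zip_cat ?sm ?sn // map_cat.
Qed.

Lemma golay_words_uniq : uniq golay_words.
Proof.
rewrite map_inj_in_uniq ?words_uniq // => m n.
rewrite !mem_words => /eqP sm /eqP sn /eqP.
by rewrite eqseq_cat ?sm ?sn // => /andP[/eqP].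
Qed.

Lemma size_golay_words : size golay_words = (2 ^ 12)%N.
Proof. by rewrite size_map size_words. Qed.

Lemma mem_octads o : (o \in octads) = golay o && (wt o == 8%N).
Proof. by rewrite mem_filter mem_golay_words andbC. Qed.

Lemma octads_uniq : uniq octads.
Proof. exact/filter_uniq/golay_words_uniq. Qed.

Lemma size_octads : size octads = 759%N.
Proof. by vm_cast_no_check (erefl 759%N). Qed.

Lemma golay_words_wt :
  all (fun c => (4 %| wt c) && ((wt c == 0) || (8 <= wt c)))%N golay_words.
Proof. by vm_cast_no_check (erefl true). Qed.

Lemma golay_wt_div4 c : golay c -> (4 %| wt c)%N.
Proof. by rewrite -mem_golay_words => /(allP golay_words_wt)/andP[]. Qed.

Lemma golay_wt_ge8 c : golay c -> wt c != 0%N -> (8 <= wt c)%N.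
Proof.
by rewrite -mem_golay_words => /(allP golay_words_wt)/andP[_ /predU1P[->|]].
Qed.

Lemma golay_negb c : golay c -> golay (map negb c).
Proof.
move=> gc; have <- : xorw (nseq 24 true) c = map negb c.
  rewrite -(size_golay gc) -map_const -[c in xorw _ c]map_id.
  by rewrite /xorw zipwith_map.
by apply: golay_xorw => //; vm_compute.
Qed.

Definition golay_automorphism (p : seq nat) : bool :=
  perm_eq p (iota 0 24) && all (fun c => golay (permute false p c)) golay_words.

Lemma golay_permute p c :
  golay_automorphism p -> golay c -> golay (permute false p c).
Proof. by case/andP => _ /allP + gc; apply; rewrite mem_golay_words. Qed.

Definition shift_perm : seq nat := rcons (rotr 1 (iota 0 23)) 23%N.

Definition multiply12_perm : seq nat :=
  rcons [seq (12 * j) %% 23 | j <- iota 0 23]%N 23%N.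

Lemma shift_automorphism : golay_automorphism shift_perm.
Proof. by vm_cast_no_check (erefl true). Qed.

Lemma multiply12_automorphism : golay_automorphism multiply12_perm.
Proof. by vm_cast_no_check (erefl true). Qed.

(** * The Leech lattice *)

(* With [m] the parity of the entries of [x], the entries that are [m + 2]
   modulo 4. *)
Definition leech_word (x : seq int) : seq bool :=
  [seq (2 <= a %% 4)%Z | a <- x].

Definition has_parity (m : bool) (x : seq int) : bool :=
  all (fun a => (a == m %[mod 2])%Z) x.

Definition leech_coset (m : bool) (x : seq int) : bool :=
  [&& golay (leech_word x), has_parity m x & (sumz x == 4 *+ m %[mod 8])%Z].

(* The lattice is scaled by the square root of 8 with respect to the even
   unimodular normalization, hence has minimal norm 32. *)
Definition leech (x : seq int) : bool :=
  leech_coset false x || leech_coset true x.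

Lemma leechP x : reflect (exists m, leech_coset m x) (leech x).
Proof.
by apply: (iffP orP) => [[]|[[]]]; [exists false | exists true | right | left].
Qed.

Lemma size_leech x : leech x -> size x = 24%N.
Proof. by move=> /leechP[m /and3P[/size_golay + _ _]]; rewrite size_map. Qed.

Lemma leech_word_vsub (m n : bool) x y : size x = size y ->
  has_parity m x -> has_parity n y ->
  leech_word (vsub x y) =
  map (addb (~~ m && n)) (xorw (leech_word x) (leech_word y)).
Proof.
elim: x y => [|a x IH] [|b y] //= [sxy] /andP[am xm] /andP[bn yn].
congr cons; last exact: IH.
by case: m am {xm IH} => am; case: n bn {yn} => bn /=; lia.
Qed.

Lemma has_parity_vsub (m n : bool) x y : size x = size y ->
  has_parity m x -> has_parity n y ->
  has_parity (m (+) n) (vsub x y).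
Proof.
elim: x y => [|a x IH] [|b y] //= [sxy] /andP[am xm] /andP[bn yn].
rewrite IH // andbT.
by case: m am {xm IH} => am; case: n bn {yn} => bn /=; lia.
Qed.

Lemma leech_vsub x y : leech x -> leech y -> leech (vsub x y).
Proof.
move=> lx ly; have sxy : size x = size y by rewrite !size_leech.
have /leechP[m /and3P[gx xm sx]] := lx; have /leechP[n /and3P[gy yn sy]] := ly.
apply/leechP; exists (m (+) n); apply/and3P; split.
- rewrite (leech_word_vsub sxy xm yn); have := golay_xorw gx gy.
  by case: (~~ m && n) => [/golay_negb|]; rewrite ?map_id.
- exact: has_parity_vsub.
- by rewrite sumz_vsub //; case: m sx {xm}; case: n sy {yn} => /=; lia.
Qed.

Lemma even_norm_ge x : has_parity false x ->
  4 *+ wt (leech_word x) <= dot x x.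
Proof.
rewrite /wt; elim: x => // a x IH /= /andP[a_even /IH]; rewrite dot_cons.
have : 4 *+ (2 <= a %% 4)%Z <= a * a.
  by case: (boolP (2 <= a %% 4)%Z) => /= a_mod; nia.
by rewrite mulrnDr; lia.
Qed.

Lemma even_norm_mod32 x : has_parity false x -> wt (leech_word x) = 0%N ->
  (dot x x == 4 * sumz x %[mod 32])%Z.
Proof.
rewrite /wt; elim: x => // a x IH /= /andP[a_even /IH {}IH]; rewrite dot_cons.
case: (boolP (2 <= a %% 4)%Z) => //= a_mod /IH x_mod.
have : (a * a == 4 * a %[mod 32])%Z.
  have [q [a_eq|a_eq]] : exists q, a = 8 * q \/ a = 8 * q + 4.
  - by exists (a %/ 8)%Z; lia.
  - have -> : a * a = 4 * a + 32 * (2 * q * q - q) by rewrite a_eq; ring.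
    by lia.
  - have -> : a * a = 4 * a + 32 * (2 * q * q + q) by rewrite a_eq; ring.
    by lia.
by move: (a * a) => sq; lia.
Qed.

Lemma odd_norm_mod16 x : has_parity true x ->
  (dot x x == 2 * sumz x + 4 *+ wt (leech_word x) - (size x)%:Z %[mod 16])%Z.
Proof.
rewrite /wt; elim: x => // a x IH /= /andP[a_odd /IH {}IH]; rewrite dot_cons.
have : (a * a == 2 * a + 4 *+ (2 <= a %% 4)%Z - 1 %[mod 16])%Z.
  have [q [a_eq|a_eq]] : exists q, a = 4 * q + 1 \/ a = 4 * q + 3.
  - by exists (a %/ 4)%Z; lia.
  - have -> : (2 <= a %% 4)%Z = false by lia.
    have -> : a * a = 2 * a - 1 + 16 * (q * q) by rewrite a_eq; ring.
    by lia.
  - have -> : (2 <= a %% 4)%Z = true by lia.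
    have -> : a * a = 2 * a + 3 + 16 * (q * q + q) by rewrite a_eq; ring.
    by lia.
by rewrite mulrnDr intS; move: (a * a) (4 *+ (2 <= a %% 4)%Z) => sq w; lia.
Qed.

Lemma odd_norm_ge x : has_parity true x -> (size x)%:Z <= dot x x.
Proof.
elim: x => // a x IH /= /andP[a_odd /IH]; rewrite dot_cons.
have : 1 <= a * a by nia.
by lia.
Qed.

Lemma leech_norm x : leech x -> dot x x = 0 \/ 32 <= dot x x.
Proof.
move=> lx; have sx := size_leech lx.
have /leechP[[] /and3P[gx x_parity x_sum]] := lx.
  have := odd_norm_mod16 x_parity; have := odd_norm_ge x_parity.
  by have := golay_wt_div4 gx; rewrite sx; right; lia.
have [wt0|wt_neq0] := eqVneq (wt (leech_word x)) 0%N.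
  by have := even_norm_mod32 x_parity wt0; have := dot_ge0 x; lia.
by have := even_norm_ge x_parity; have := golay_wt_ge8 gx wt_neq0; right; lia.
Qed.

Definition leech_min (x : seq int) : bool := leech x && (dot x x == 32).

Lemma leech_min_dot x y : leech_min x -> leech_min y -> x != y -> dot x y <= 16.
Proof.
move=> /andP[lx /eqP nx] /andP[ly /eqP ny] neq_xy.
have sxy : size x = size y by rewrite !size_leech.
have := dot_vsub sxy; rewrite nx ny.
have [/(vsub_eq0 sxy) eq_xy|] := leech_norm (leech_vsub lx ly); last lia.
by rewrite eq_xy eqxx in neq_xy.
Qed.

Lemma leech_word_permute n p x : all (gtn n) p -> size x = n ->
  leech_word (permute 0 p x) = permute false p (leech_word x).
Proof.
move=> /allP p_lt sx; rewrite /leech_word /permute -map_comp.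
by apply/eq_in_map => i /p_lt ip; rewrite /= (nth_map 0) // sx.
Qed.

Lemma leech_min_permute p x :
  golay_automorphism p -> leech_min x -> leech_min (permute 0 p x).
Proof.
move=> aut_p /andP[lx nx]; have sx := size_leech lx.
have /andP[perm_p _] := aut_p.
have p_lt : all (gtn 24) p.
  by apply/allP => i; rewrite (perm_mem perm_p) mem_iota.
apply/andP; split; last by rewrite (dot_permute perm_p).
have /leechP[m /and3P[gx /allP xm x_sum]] := lx.
apply/leechP; exists m; apply/and3P; split.
- by rewrite (leech_word_permute p_lt) ?golay_permute.
- apply/allP => _ /mapP[i /(allP p_lt) ip ->].
  by apply: xm; rewrite mem_nth ?sx.
- by rewrite (sumz_permute perm_p).
Qed.

(** * Minimal vectors of the Leech lattice *)

(* Locked, because unification would otherwise compute the lists. *)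
HB.lock Definition pair_vectors : seq (seq int) :=
  [seq x | o <- words_of_weight 24 2, x <- signings 4 o].

HB.lock Definition octad_vectors : seq (seq int) :=
  [seq x | o <- octads,
           x <- [seq x <- signings 2 o | (sumz x == 0 %[mod 8])%Z]].

Definition odd_vector (c : seq bool) (i : nat) : seq int :=
  mkseq (fun j => (if j == i then -3 else 1) * (-1) ^+ nth false c j) (size c).

HB.lock Definition odd_vectors : seq (seq int) :=
  [seq x | c <- golay_words, x <- [seq odd_vector c i | i <- iota 0 24]].

Definition leech_vectors : seq (seq int) :=
  pair_vectors ++ octad_vectors ++ odd_vectors.

Lemma has_parity_signing (v : int) o x :
  has_parity false [:: v] -> x \in signings v o -> has_parity false x.
Proof.
rewrite /= andbT => v_even x_o; pose even (a : int) := (a == false %[mod 2])%Z.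
have even_x : map even x = map (fun=> true) o.
  by apply: signings_map x_o => //; rewrite /even; lia.
rewrite -[has_parity _ _]/(all (preim even id) x) -all_map even_x.
by rewrite all_map all_predT.
Qed.

Lemma pair_vectorsP x : x \in pair_vectors ->
  exists2 o, size o = 24%N /\ wt o = 2%N & x \in signings 4 o.
Proof.
rewrite pair_vectors.unlock => /allpairsPdep[o [y []]].
by rewrite mem_words_of_weight => /andP[/eqP so /eqP wo] yo ->; exists o.
Qed.

Lemma leech_word_pair_vectors x :
  x \in pair_vectors -> leech_word x = nseq 24 false.
Proof.
case/pair_vectorsP => o [so _] xo; rewrite -so -map_const.
exact: signings_map xo.
Qed.

Lemma pair_vectors_even x : x \in pair_vectors -> has_parity false x.
Proof. by case/pair_vectorsP => o _; apply: has_parity_signing. Qed.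

Lemma pair_vectors_min x : x \in pair_vectors -> leech_min x.
Proof.
move=> x40; have [o [so wo] xo] := pair_vectorsP x40.
rewrite /leech_min (dot_signing xo) wo andbT; apply/leechP; exists false.
rewrite /leech_coset leech_word_pair_vectors // pair_vectors_even //.
by apply/and3P; split=> //; have := sumz_signing xo; rewrite wo; lia.
Qed.

Lemma octad_vectorsP x : x \in octad_vectors ->
  exists2 o, golay o /\ wt o = 8%N
    & x \in signings 2 o /\ (sumz x == 0 %[mod 8])%Z.
Proof.
rewrite octad_vectors.unlock => /allpairsPdep[o [y []]].
by rewrite mem_octads mem_filter => /andP[go /eqP wo] /andP[sy yo] ->; exists o.
Qed.

Lemma octad_vectors_even x : x \in octad_vectors -> has_parity false x.
Proof. by case/octad_vectorsP => o _ [xo _]; apply: has_parity_signing xo. Qed.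

Lemma leech_word_signing o x : x \in signings 2 o -> leech_word x = o.
Proof. by move=> xo; rewrite -[RHS]map_id; apply: signings_map xo. Qed.

Lemma octad_vectors_min x : x \in octad_vectors -> leech_min x.
Proof.
move=> x20; have [o [go wo] [xo sx]] := octad_vectorsP x20.
rewrite /leech_min (dot_signing xo) wo andbT; apply/leechP; exists false.
by rewrite /leech_coset (leech_word_signing xo) go octad_vectors_even.
Qed.

Lemma sum_signs (c : seq bool) :
  \sum_(j < size c) (-1) ^+ nth false c j = (size c)%:Z - 2 *+ wt c.
Proof.
rewrite /wt; elim: c => [|b c IH]; first by rewrite big_ord0.
rewrite big_ord_recl /= IH intS mulrnDr.
by case: b; rewrite ?expr0 ?expr1 ?mulr0n ?mulr1n; ring.
Qed.

Section OddVector.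
Variables (c : seq bool) (i : nat).

Lemma nth_odd_vector j : (j < size c)%N -> (odd_vector c i)`_j =
  (if j == i then -3 else 1) * (-1) ^+ nth false c j.
Proof. exact: nth_mkseq. Qed.

Lemma leech_word_odd_vector : leech_word (odd_vector c i) = c.
Proof.
apply: (@eq_from_nth _ false) => [|j]; rewrite size_map size_mkseq // => jc.
rewrite (nth_map 0) ?size_mkseq // nth_odd_vector //.
by case: (j == i); case: nth.
Qed.

Lemma odd_vector_odd : has_parity true (odd_vector c i).
Proof. by apply/allP => a /mapP[j _ ->]; case: (j == i); case: nth. Qed.

Hypothesis ic : (i < size c)%N.

Lemma dot_odd_vector : dot (odd_vector c i) (odd_vector c i) = (size c + 8)%:Z.
Proof.
rewrite (@dot_nth (size c)) ?minnn ?size_mkseq // big_mkord.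
rewrite (bigD1 (Ordinal ic)) //= nth_odd_vector // eqxx.
rewrite (eq_bigr (fun=> 1)) => [|j neq_ji].
  by rewrite sumr_const cardC1 card_ord; case: nth => //=; lia.
by rewrite nth_odd_vector // ifN //; case: nth.
Qed.

Lemma sumz_odd_vector :
  sumz (odd_vector c i) = (size c)%:Z - 2 *+ wt c - 4 * (-1) ^+ nth false c i.
Proof.
rewrite (@sumz_nth (size c)) ?size_mkseq // big_mkord -sum_signs.
rewrite (bigD1 (Ordinal ic)) //= [in RHS](bigD1 (Ordinal ic)) //=.
rewrite nth_odd_vector // eqxx.
rewrite (eq_bigr (fun j : 'I__ => (-1) ^+ nth false c j)) => [|j neq_ji].
  by ring.
by rewrite nth_odd_vector // ifN // mul1r.
Qed.

End OddVector.

Lemma odd_vector_inj c : {in gtn (size c) &, injective (odd_vector c)}.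
Proof.
move=> i j ic jc /(congr1 (fun x => x`_i)); rewrite !nth_odd_vector // eqxx.
by case: eqP => // _; case: nth.
Qed.

Lemma odd_vectorsP x : x \in odd_vectors ->
  exists c i, [/\ golay c, (i < size c)%N & x = odd_vector c i].
Proof.
rewrite odd_vectors.unlock => /allpairsPdep[c [y []]].
rewrite mem_golay_words => gc /mapP[i + ->] ->.
by rewrite mem_iota => i_lt; exists c, i; rewrite size_golay.
Qed.

Lemma odd_vectors_odd x : x \in odd_vectors -> has_parity true x.
Proof. by case/odd_vectorsP => c [i [_ _ ->]]; apply: odd_vector_odd. Qed.

Lemma odd_vectors_min x : x \in odd_vectors -> leech_min x.
Proof.
case/odd_vectorsP => c [i [gc ic ->]].
rewrite /leech_min dot_odd_vector // (size_golay gc) andbT.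
apply/leechP; exists true.
rewrite /leech_coset leech_word_odd_vector gc odd_vector_odd.
rewrite sumz_odd_vector // (size_golay gc).
by have := golay_wt_div4 gc; case: nth; rewrite ?expr0 ?expr1; lia.
Qed.

Lemma pair_vectors_uniq : uniq pair_vectors.
Proof.
rewrite pair_vectors.unlock.
apply: (allpairs_fibers_uniq (g := map (fun a => a != 0))).
- by move=> o _; apply: signings_uniq.
- by move=> o _ x xo; rewrite -[RHS]map_id; apply: signings_map xo.
- exact: words_of_weight_uniq.
Qed.

Lemma octad_vectors_uniq : uniq octad_vectors.
Proof.
rewrite octad_vectors.unlock; apply: (allpairs_fibers_uniq (g := leech_word)).
- by move=> o _; apply/filter_uniq/signings_uniq.
- by move=> o _ x; rewrite mem_filter => /andP[_ /leech_word_signing].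
- exact: octads_uniq.
Qed.

Lemma odd_vectors_uniq : uniq odd_vectors.
Proof.
rewrite odd_vectors.unlock; apply: (allpairs_fibers_uniq (g := leech_word)).
- move=> c; rewrite mem_golay_words => /size_golay sc.
  rewrite map_inj_in_uniq ?iota_uniq // => i j; rewrite !mem_iota => ic jc.
  by apply: odd_vector_inj; rewrite unfold_in sc.
- by move=> c _ x /mapP[i _ ->]; apply: leech_word_odd_vector.
- exact: golay_words_uniq.
Qed.

Lemma size_pair_vectors : size pair_vectors = ('C(24, 2) * 2 ^ 2)%N.
Proof.
rewrite pair_vectors.unlock -(size_words_of_weight 24).
apply: size_allpairs_fibers => o.
by rewrite mem_words_of_weight size_signings => /andP[_ /eqP ->].
Qed.

Lemma size_octad_vectors : size octad_vectors = (759 * 2 ^ 7)%N.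
Proof.
rewrite octad_vectors.unlock -size_octads; apply: size_allpairs_fibers => o.
rewrite mem_octads size_filter => /andP[_ /eqP wo].
by rewrite (@count_signings o 0) wo.
Qed.

Lemma size_odd_vectors : size odd_vectors = (2 ^ 12 * 24)%N.
Proof.
rewrite odd_vectors.unlock -size_golay_words.
apply: size_allpairs_fibers => c _.
by rewrite size_map size_iota.
Qed.

Lemma leech_vectors_min x : x \in leech_vectors -> leech_min x.
Proof.
rewrite /leech_vectors !mem_cat.
by move=> /or3P[/pair_vectors_min|/octad_vectors_min|/odd_vectors_min].
Qed.

Lemma even_odd_nil x : has_parity false x -> has_parity true x -> x = [::].
Proof. by case: x => // a x /andP[+ _] /andP[+ _]; lia. Qed.

Lemma leech_vectors_uniq : uniq leech_vectors.
Proof.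
have odd_vectors_not_even x : x \in odd_vectors -> ~~ has_parity false x.
  move=> x31; apply/negP => /even_odd_nil/(_ (odd_vectors_odd x31)) x_nil.
  by have /andP[/size_leech] := odd_vectors_min x31; rewrite x_nil.
have octad_vectors_not_pair x : x \in octad_vectors -> x \notin pair_vectors.
  case/octad_vectorsP => o [_ wo] [/leech_word_signing eo _].
  by apply/negP => /leech_word_pair_vectors; rewrite eo => o0; rewrite o0 in wo.
rewrite /leech_vectors cat_uniq; apply/and3P; split.
- exact: pair_vectors_uniq.
- apply/hasPn => x; rewrite mem_cat => /orP[/octad_vectors_not_pair //|].
  by move=> /odd_vectors_not_even; apply: contra => /pair_vectors_even.
rewrite cat_uniq; apply/and3P; split.
- exact: octad_vectors_uniq.
- by apply/hasPn => x /odd_vectors_not_even; apply/contra/octad_vectors_even.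
- exact: odd_vectors_uniq.
Qed.

Lemma size_leech_vectors : size leech_vectors = nat_of_bin 196560%num.
Proof.
rewrite /leech_vectors !size_cat.
rewrite size_pair_vectors size_octad_vectors size_odd_vectors.
by rewrite (_ : 'C(24, 2) = 276%N) //; lia.
Qed.

(** * Disjoint sets of minimal vectors with inner products at most 8 *)

Definition sparse (T : seq (seq int)) : bool :=
  all leech_min T && pairwise (fun x y => dot x y <= 8) T.

Lemma sparse_min T : sparse T -> {in T, forall x, leech_min x}.
Proof. by case/andP => /allP. Qed.

Lemma sparse_dot T : sparse T -> {in T &, forall x y, x != y -> dot x y <= 8}.
Proof.
case/andP => _ dT x y xT yT neq_xy.
have dot_sym : symmetric (fun x y => dot x y <= 8).
  by move=> u v; rewrite dotC.
rewrite -(nth_index [::] xT) -(nth_index [::] yT).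
apply: (pairwise_nth [::] dot_sym dT); rewrite ?index_mem //.
by apply: contraNneq neq_xy => eq_i; rewrite -(nth_index x xT) eq_i nth_index.
Qed.

Lemma sparse_permute p T :
  golay_automorphism p -> sparse T -> sparse (map (permute 0 p) T).
Proof.
move=> aut_p /andP[minT dT]; have /andP[perm_p _] := aut_p.
have sizeT x : x \in T -> size x = 24%N.
  by move=> /(allP minT)/andP[/size_leech].
apply/andP; split.
  by rewrite all_map; apply: sub_all minT => x; apply: leech_min_permute.
rewrite pairwise_map; apply: (sub_in_pairwise (P := mem T)) dT => [x y xT yT|].
  by rewrite /= (dot_permute perm_p) ?sizeT.
exact/allP.
Qed.

(* Each vector is a number whose 24 hexadecimal digits are its coordinates in
   two's complement, so [e] is -2 and [c] is -4. *)
Definition signed_digit (d : BinNums.N) : int :=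
  if (d < 8)%N then (d : nat)%:Z else (d : nat)%:Z - 16.

Definition decode (a : BinNums.N) : seq int :=
  rev [seq signed_digit (BinNat.N.land b 15)
      | b <- traject (BinNat.N.shiftr^~ 4%num) a 24].

(* Found by computer. *)
Definition orbit_representatives : seq BinNums.N :=
  [::
    0x0000000000004000000c0000; 0x000000000004000000000004;
    0x00000000e2e20e2020000e00; 0x00000000ee220e20e0000200;
    0x000000220000020ee0e020e0; 0x0000002200000e0e20202020;
    0x000000222e0ee020000e0000; 0x0000002e220e202000020000;
    0x00000200200000000202eeee; 0x0000020020000000020e222e;
    0x00000200200000000e0222e2; 0x00000200200000000e0eee22;
    0x000002002020200e02e00002; 0x000002002020e0020ee0000e;
    0x0000020020e0200e0e20000e; 0x0000020020e0e00202200002;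
    0x00000200e00000000202e222; 0x00000200e0000000020e2ee2;
    0x00000200e00000000e022e2e; 0x00000200e00000000e0ee2ee;
    0x00000200e02020020e200002; 0x00000200e020e00e0220000e;
    0x00000200e0e0200202e0000e; 0x00000200e0e0e00e0ee00002;
    0x00002000020020020200ee02; 0x00002000020020020e00220e;
    0x000020000200e00e02002202; 0x000020000200e00e0e00ee0e;
    0x000020000220000002ee00ee; 0x00002000022000000ee20022;
    0x0000200002e000000222002e; 0x0000200002e000000e2e00e2;
    0x000020000e00200e0200e20e; 0x000020000e00200e0e002e02;
    0x000020000e00e00202002e0e; 0x000020000e00e0020e00e202;
    0x000020000e200000022200e2; 0x000020000e2000000e2e002e;
    0x000020000ee0000002ee0022; 0x000020000ee000000ee200ee;
    0x000040000000004000000000; 0x0000e200000202e020202000;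
    0x0000ee00000202e0e0e0e000; 0x0002000222000022e00000e0;
    0x000200022e0000eee0000020; 0x00020020e2000ee00020e000;
    0x000200e0ee00022000e02000; 0x00022220ee0e0000e0000000;
    0x00022ee0e2020000e0000000; 0x0002e20e000020e0e0020000;
    0x0002ee0e0000e020e00e0000; 0x00200200020020000ee00ee0;
    0x002002000200e0000e200220; 0x002002000220000202022000;
    0x0020020002e0000e020ee000; 0x002002000e20000e0e02e000;
    0x002002000ee000020e0e2000; 0x00200e000200200002e00220;
    0x00200e000200e00002200ee0; 0x020020002000200000200222;
    0x020020002000e00000e00ee2; 0x020020002020000e0002200e;
    0x0200200020e00002000ee00e; 0x02002000e000200000200eee;
    0x02002000e000e00000e0022e; 0x0200e000e0200002000e200e;
    0x0200e000e0e0000e0002e00e; 0x200000020020022000202200;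
    0x2000000e002002e000e02e00; 0x20200020ee00002020000002;
    0x202000e02e000020e000000e]%num.

Definition monomial_map (x : seq int) : seq int := zipwith *%R
  [:: 1; 1; -1; 1; -1; -1; 1; -1; -1; -1; -1; 1;
      -1; 1; -1; -1; 1; -1; 1; -1; -1; 1; -1; 1]%Z
  (permute 0 [:: 14; 8; 17; 6; 4; 5; 7; 11; 23; 2; 20; 16;
                 12; 3; 0; 10; 13; 9; 22; 19; 15; 18; 21; 1]%N x).

Definition sparse_vectors : seq (seq int) :=
  undup [seq x | a <- orbit_representatives,
                 x <- traject monomial_map (decode a) 12].

Lemma sparse_vectors_sparse : sparse sparse_vectors.
Proof. by vm_cast_no_check (erefl true). Qed.

Definition sparse_copies : seq (seq (seq int)) :=
  let shift := map (permute 0 shift_perm) in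
  traject shift sparse_vectors 23 ++
  traject shift (map (permute 0 multiply12_perm) sparse_vectors) 19.

Lemma sparse_copies_sparse : all sparse sparse_copies.
Proof.
have sparse_traject n T :
    sparse T -> all sparse (traject (map (permute 0 shift_perm)) T n).
  elim: n T => //= n IH T spT; rewrite spT IH //.
  exact/sparse_permute/spT/shift_automorphism.
have sparse0 := sparse_vectors_sparse.
rewrite all_cat; apply/andP; split; apply: sparse_traject.
  exact: sparse0.
exact: sparse_permute multiply12_automorphism sparse0.
Qed.

Lemma union_sizeE Ss :
  union_size Ss = size (dedup (sort <=%O (flatten Ss : seq (seqlexi int)))).
Proof. exact: (size_undup_sort (flatten Ss : seq (seqlexi int))). Qed.

Lemma union_size_sparse_copies :
  [/\ [/\ 488%num <= union_size (take 1 sparse_copies),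
          976%num <= union_size (take 2 sparse_copies),
          1708%num <= union_size (take 4 sparse_copies) &
          3904%num <= union_size (take 8 sparse_copies)],
      5856%num <= union_size (take 12 sparse_copies),
      11712%num <= union_size (take 24 sparse_copies) &
      18157%num <= union_size (take 42 sparse_copies)]%N.
Proof.
by split; [split|..]; rewrite union_sizeE; vm_cast_no_check (erefl true).
Qed.

(** * Lifting the minimal vectors of the Leech lattice *)

Definition obtuse_partition (w : seq int) (n : int) (c : nat)
    (Ys : seq (seq (seq int))) : bool :=
  [&& all (>= 0) w, 0 < n,
      all (fun Y => [&& size Y == c, all (fun y => wdot w y y == n) Y
                      & pairwise (fun y z => 2 * wdot w y z <= - n) Y]) Ys
    & pairwise (fun Y Z => allrel (fun y z => 2 * wdot w y z <= n) Y Z) Ys].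

Section ObtusePartition.
Variables (R : realType) (w : seq int) (n : int) (c : nat).
Variable Ys : seq (seq (seq int)).
Hypothesis Ys_obtuse : obtuse_partition w n c Ys.

Definition partition_vector (p : 'I_(size Ys) * 'I_c) : seq int :=
  nth [::] (nth [::] Ys p.1) p.2.

Definition partition_family (p : 'I_(size Ys) * 'I_c) : 'rV[R]_(size w) :=
  normalize R w n (partition_vector p).

Let w_ge0 : all (>= 0) w. Proof. by case/and4P: Ys_obtuse. Qed.

Let n_gt0 : 0 < n. Proof. by case/and4P: Ys_obtuse. Qed.

Let block_obtuse (j : 'I_(size Ys)) : let Y := nth [::] Ys j in
  [/\ size Y = c, all (fun y => wdot w y y == n) Y
    & pairwise (fun y z => 2 * wdot w y z <= - n) Y].
Proof.
by case/and4P: Ys_obtuse => _ _ /(all_nthP [::])/(_ j (ltn_ord j))/and3P[/eqP].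
Qed.

Let wdot_sym (d : int) : symmetric (fun y z => 2 * wdot w y z <= d).
Proof. by move=> y z; rewrite wdotC. Qed.

Lemma wdot_fiber j a b : a != b ->
  2 * wdot w (partition_vector (j, a)) (partition_vector (j, b)) <= - n.
Proof.
have [size_Y _ Y_obtuse] := block_obtuse j.
have := @pairwise_nth _ _ [::] _ a b (wdot_sym (- n)) Y_obtuse.
by rewrite size_Y !ltn_ord; apply.
Qed.

Lemma dotp_partition_fiber j a b : a != b ->
  dotp (partition_family (j, a)) (partition_family (j, b)) <= - (1 / 2).
Proof.
move=> neq_ab; rewrite -mulNr (@dotp_normalize_le _ _ _ _ _ (-1) 2) // mulN1r.
exact: wdot_fiber.
Qed.

Lemma kissing_partition : kissing_family partition_family.
Proof.
apply: kissing_normalize => // [[j a]|[i a] [j b] neq_ia_jb].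
  have [size_Y /allP Y_norm _] := block_obtuse j.
  by apply/eqP/Y_norm; rewrite mem_nth ?size_Y.
have [eq_ij|neq_ij] := eqVneq i j.
  have neq_ab : a != b by apply: contraNneq neq_ia_jb => ->; rewrite eq_ij.
  by rewrite eq_ij; apply: le_trans (wdot_fiber j neq_ab) _; lia.
have [[size_Yi _ _] [size_Yj _ _]] := (block_obtuse i, block_obtuse j).
have /and4P[_ _ _ Ys_pairwise] := Ys_obtuse.
have allrel_sym : symmetric (allrel (fun y z => 2 * wdot w y z <= n)).
  by move=> Y Z; rewrite allrelC; apply: eq_allrel => y z; rewrite wdotC.
have := pairwise_nth [::] allrel_sym Ys_pairwise (ltn_ord i) (ltn_ord j) neq_ij.
by move=> /allrelP; apply; rewrite mem_nth ?size_Yi ?size_Yj.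
Qed.

End ObtusePartition.

Section LeechNormalize.
Variable R : realType.

Definition leech_normalize : seq int -> 'rV[R]_24 := normalize R (nseq 24 1) 32.

Lemma kissing_leech_min (I : eqType) (v : I -> seq int) :
  injective v -> (forall i, leech_min (v i)) ->
  kissing_family (fun i => leech_normalize (v i)).
Proof.
move=> v_inj v_min; have size_v i : size (v i) = 24%N.
  by have /andP[/size_leech] := v_min i.
apply: (@kissing_normalize R I (nseq 24 1) 32) => // [i|i j neq_ij];
  rewrite wdot_nseq1 //.
  by have /andP[_ /eqP] := v_min i.
have := leech_min_dot (v_min i) (v_min j); rewrite (inj_eq v_inj) neq_ij.
by move/(_ isT); lia.
Qed.

Lemma dotp_sparse T : sparse T -> {in T &, forall x y, x != y ->
  dotp (leech_normalize x) (leech_normalize y) <= 1 / 4}.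
Proof.
move=> sparse_T x y xT yT neq_xy.
have /andP[/size_leech size_x _] := sparse_min sparse_T xT.
rewrite (@dotp_normalize_le R (nseq 24 1) 32 x y 1 4) // wdot_nseq1 //.
by have := sparse_dot sparse_T xT yT neq_xy; lia.
Qed.

End LeechNormalize.

Section LeechLift.
Variables (R : realType) (Ss : seq (seq (seq int))).
Hypothesis Ss_sparse : all sparse Ss.

Definition fixed_vectors : seq (seq int) :=
  [seq x <- leech_vectors | x \notin flatten Ss].

Definition leech_index : Type :=
  (seq_sub fixed_vectors + seq_sub (undup (flatten Ss)))%type.

Definition leech_vector (p : leech_index) : seq int :=
  match p with inl x => ssval x | inr x => ssval x end.

Lemma leech_vector_inj : injective leech_vector.
Proof.
have fixedN (x : seq_sub fixed_vectors) (y : seq_sub (undup (flatten Ss))) :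
    ssval x != ssval y.
  have := ssvalP x; rewrite mem_filter => /andP[xS _].
  by apply: contraNneq xS => ->; have := ssvalP y; rewrite mem_undup.
case=> x [] y /= eq_xy.
- by congr inl; apply: val_inj.
- by have := fixedN x y; rewrite eq_xy eqxx.
- by have := fixedN y x; rewrite eq_xy eqxx.
- by congr inr; apply: val_inj.
Qed.

Lemma union_min x : x \in flatten Ss -> leech_min x.
Proof. by case/flattenP => S /(allP Ss_sparse)/sparse_min; apply. Qed.

Lemma leech_vector_min p : leech_min (leech_vector p).
Proof.
case: p => [[x]|[x]] /=; rewrite ?mem_filter ?mem_undup.
  by case/andP => _; apply: leech_vectors_min.
exact: union_min.
Qed.

Lemma size_fixed_vectors :
  (size leech_vectors <= size fixed_vectors + union_size Ss)%N.
Proof.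
rewrite -(count_predC (mem (flatten Ss)) leech_vectors) addnC size_filter.
rewrite leq_add2l -size_filter; apply: uniq_leq_size.
  exact/filter_uniq/leech_vectors_uniq.
by move=> x; rewrite mem_filter mem_undup => /andP[].
Qed.

Variables (w : seq int) (n : int) (c : nat) (Ys : seq (seq (seq int))).
Hypothesis Ys_obtuse : obtuse_partition w n c.+1 Ys.
Hypothesis le_Ss_Ys : (size Ss <= size Ys)%N.

Lemma kissing_number_ge_leech_lift (N : BinNums.N) :
  (N <= size leech_vectors + c * union_size Ss)%N ->
  kissing_number_ge R (24 + size w) N.
Proof.
move=> leN; pose K := seq_sub (undup (flatten Ss)).
have unionP (x : K) : ssval x \in flatten Ss.
  by have := ssvalP x; rewrite mem_undup.
have label_lt (x : K) : (set_index Ss (ssval x) < size Ys)%N.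
  by have [/leq_trans->] := set_indexP (unionP x).
pose label (x : K) := Ordinal (label_lt x).
have dotp_label (s t : K) : s != t -> label s = label t ->
    dotp (leech_normalize R (ssval s)) (leech_normalize R (ssval t)) <= 1 / 4.
  move=> neq_st [eq_label]; have [lt_s s_in] := set_indexP (unionP s).
  have [_ t_in] := set_indexP (unionP t); rewrite -eq_label in t_in.
  exact: (dotp_sparse R (all_nthP [::] Ss_sparse _ lt_s)) s_in t_in neq_st.
have kissing_x := kissing_leech_min R leech_vector_inj leech_vector_min.
have kissing_y := kissing_partition R Ys_obtuse.
have := kissing_lift kissing_x dotp_label kissing_y
  (dotp_partition_fiber R Ys_obtuse).
move=> /kissing_number_ge_family; apply; rewrite card_sum card_prod card_ord.
rewrite !card_seq_sub ?undup_uniq ?filter_uniq ?leech_vectors_uniq //.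
rewrite -/(union_size Ss) mulnS addnA (mulnC _ c).
by apply: leq_trans leN _; rewrite leq_add2r size_fixed_vectors.
Qed.

End LeechLift.

(** * Triangles in root systems *)

Definition vopp : seq int -> seq int := map -%R.

Definition triangle (a b : seq int) : seq (seq int) :=
  [:: a; b; vsub (vopp a) b].

Definition with_opposites (Ys : seq (seq (seq int))) : seq (seq (seq int)) :=
  Ys ++ map (map vopp) Ys.

Definition with_rotations (k : nat) (Ys : seq (seq (seq int))) :
    seq (seq (seq int)) :=
  [seq map (rot i) Y | Y <- Ys, i <- iota 0 k].

Definition A1_pair : seq (seq (seq int)) := [:: [:: [:: 1]; [:: -1]]]%Z.

Definition A2_triangles : seq (seq (seq int)) :=
  with_opposites [:: triangle [:: 2; 0] [:: -1; 1]]%Z.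

Definition D3_triangles : seq (seq (seq int)) :=
  [:: triangle [:: 1; 0; 1] [:: 0; -1; -1];
      triangle [:: 1; 1; 0] [:: 0; -1; 1];
      triangle [:: 1; -1; 0] [:: 0; 1; -1];
      triangle [:: 1; 0; -1] [:: 0; 1; 1]].

Definition D4_triangles : seq (seq (seq int)) := with_opposites
  [:: triangle [:: 1; 0; 0; -1] [:: 0; -1; 0; 1];
      triangle [:: 0; 1; 1; 0] [:: 0; 0; -1; 1];
      triangle [:: 1; 1; 0; 0] [:: 0; -1; 1; 0];
      triangle [:: 1; 0; 0; 1] [:: 0; 0; -1; -1]].

Definition D5_triangles : seq (seq (seq int)) :=
  [:: triangle [:: 0; 1; 0; 0; -1] [:: 0; 0; 0; -1; 1];
      triangle [:: 1; -1; 0; 0; 0] [:: 0; 1; 1; 0; 0];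
      triangle [:: 0; 1; 0; 0; 1] [:: 0; 0; 0; 1; -1];
      triangle [:: 0; 1; -1; 0; 0] [:: 0; 0; 1; 0; -1];
      triangle [:: 1; 1; 0; 0; 0] [:: 0; -1; -1; 0; 0];
      triangle [:: 1; 0; 0; 0; -1] [:: 0; 0; 0; 1; 1];
      triangle [:: 1; 0; 0; -1; 0] [:: 0; 1; 0; 1; 0];
      triangle [:: 1; 0; 0; 0; 1] [:: 0; -1; 0; 0; -1];
      triangle [:: 1; 0; -1; 0; 0] [:: 0; 0; 1; -1; 0];
      triangle [:: 1; 0; 0; 1; 0] [:: 0; 0; 0; -1; -1];
      triangle [:: 1; 0; 1; 0; 0] [:: 0; 0; -1; 0; 1];
      triangle [:: 0; 1; 0; -1; 0] [:: 0; 0; -1; 1; 0]].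

(* The roots of E6 are those of D5, scaled by 2, and the vectors
   [(+-1, ..., +-1, +- sqrt 3)] with an even number of minus signs. *)
Definition E6_triangles : seq (seq (seq int)) := with_opposites
  [:: triangle [:: 1; 1; 1; 1; -1; -1] [:: 0; -2; 0; 0; 2; 0];
      triangle [:: 2; 0; 0; -2; 0; 0] [:: -1; 1; 1; 1; -1; 1];
      triangle [:: 1; -1; 1; -1; -1; -1] [:: 0; 0; -2; 2; 0; 0];
      triangle [:: 1; 1; -1; 1; 1; -1] [:: 0; 0; 0; -2; -2; 0];
      triangle [:: 2; 0; 2; 0; 0; 0] [:: 0; 0; -2; 0; -2; 0];
      triangle [:: 0; 2; 2; 0; 0; 0] [:: 0; 0; -2; 0; 2; 0];
      triangle [:: 2; 0; -2; 0; 0; 0] [:: 0; -2; 2; 0; 0; 0];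
      triangle [:: 1; -1; 1; 1; -1; 1] [:: 0; 0; 0; -2; 2; 0];
      triangle [:: 1; 1; 1; 1; 1; 1] [:: 0; 0; -2; -2; 0; 0];
      triangle [:: 2; 2; 0; 0; 0; 0] [:: 0; -2; 0; 2; 0; 0];
      triangle [:: 2; 0; 0; 0; 2; 0] [:: -1; 1; 1; -1; -1; -1];
      triangle [:: 1; 1; -1; 1; -1; 1] [:: 0; -2; 0; -2; 0; 0]].

(* The roots of E7 are the vectors with one entry [+-2], and those with entries
   [+-1] on the complement of a line [{i, i + 1, i + 3}] of the Fano plane. *)
Definition E7_triangles : seq (seq (seq int)) := with_rotations 7
  [:: triangle [:: 1; 1; 1; 0; 0; -1; 0] [:: 0; 0; -1; 0; 1; 1; -1];
      triangle [:: 1; 1; -1; 0; 0; 1; 0] [:: 0; 0; 1; 0; -1; -1; -1];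
      triangle [:: 2; 0; 0; 0; 0; 0; 0] [:: -1; 1; 1; 0; 0; 1; 0];
      triangle [:: 1; 0; 1; -1; 1; 0; 0] [:: 1; 0; -1; 1; -1; 0; 0];
      triangle [:: 1; 1; 1; 0; 0; 1; 0] [:: 0; -1; -1; 1; 0; 0; -1];
      triangle [:: 1; 1; 0; 0; -1; 0; -1] [:: 0; -1; -1; 1; 0; 0; 1]].

Lemma A1_obtuse : obtuse_partition [:: 1] 1 2 A1_pair.
Proof. by vm_compute. Qed.

Lemma A2_obtuse : obtuse_partition [:: 1; 3] 4 3 A2_triangles.
Proof. by vm_compute. Qed.

Lemma D3_obtuse : obtuse_partition (nseq 3 1) 2 3 D3_triangles.
Proof. by vm_compute. Qed.

Lemma D4_obtuse : obtuse_partition (nseq 4 1) 2 3 D4_triangles.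
Proof. by vm_compute. Qed.

Lemma D5_obtuse : obtuse_partition (nseq 5 1) 2 3 D5_triangles.
Proof. by vm_compute. Qed.

Lemma E6_obtuse : obtuse_partition (rcons (nseq 5 1) 3) 8 3 E6_triangles.
Proof. by vm_compute. Qed.

Lemma E7_obtuse : obtuse_partition (nseq 7 1) 4 3 E7_triangles.
Proof. by vm_compute. Qed.

Lemma kissing_number_ge_sparse_copies (R : realType) w n c Ys
    (M N : BinNums.N) :
  obtuse_partition w n c.+1 Ys ->
  (M <= union_size (take (size Ys) sparse_copies))%N ->
  nat_of_bin N = (196560%num + c * M)%N -> kissing_number_ge R (24 + size w) N.
Proof.
move=> Ys_obtuse leM eqN.
have sparse_take : all sparse (take (size Ys) sparse_copies).
  by apply/allP => S /mem_take/(allP sparse_copies_sparse).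
have size_take_le : (size (take (size Ys) sparse_copies) <= size Ys)%N.
  by rewrite size_take_min geq_minl.
apply: (kissing_number_ge_leech_lift R sparse_take Ys_obtuse size_take_le).
by rewrite eqN size_leech_vectors leq_add2l leq_mul2l leM orbT.
Qed.

Theorem theorem3p1 (R : realType) :
  kissing_number_ge R 25 197048%num /\
  kissing_number_ge R 26 198512%num /\
  kissing_number_ge R 27 199976%num /\
  kissing_number_ge R 28 204368%num /\
  kissing_number_ge R 29 208272%num /\
  kissing_number_ge R 30 219984%num /\
  kissing_number_ge R 31 232874%num.
Proof.
have [[union1 union2 union4 union8] union12 union24 union42] :=
  union_size_sparse_copies.
do 6?split.
- apply: (kissing_number_ge_sparse_copies R A1_obtuse union1); clear; lia.
- apply: (kissing_number_ge_sparse_copies R A2_obtuse union2); clear; lia.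
- apply: (kissing_number_ge_sparse_copies R D3_obtuse union4); clear; lia.
- apply: (kissing_number_ge_sparse_copies R D4_obtuse union8); clear; lia.
- apply: (kissing_number_ge_sparse_copies R D5_obtuse union12); clear; lia.
- apply: (kissing_number_ge_sparse_copies R E6_obtuse union24); clear; lia.
- apply: (kissing_number_ge_sparse_copies R E7_obtuse union42); clear; lia.
Qed.
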